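(* The forgetful functor $\mathsf{Grp}\to\mathsf{aGrp}$ from groups to almost groups is not full.
   Context: A piecewise group is a set $G$ equipped with a reflexive and symmetric relation ${\perp\!\!\!\perp}\subseteq G\times G$ (if $x\mathrel{\perp\!\!\!\perp} y$ one says $x$ and $y$ commute), a binary operation $\cdot:{\perp\!\!\!\perp}\to G$, and a distinguished element $1\in G$, such that every subset $C\subseteq G$ of pairwise commuting elements is contained in some subset $\bar C\subseteq G$ of pairwise commuting elements which is an abelian group with respect to these data. A piecewise group homomorphism $\zeta:G\to H$ is a function such that whenever $g\mathrel{\perp\!\!\!\perp} h$ in $G$, one has $\zeta(g)\mathrel{\perp\!\!\!\perp}\zeta(h)$ and $\zeta(gh)=\zeta(g)\zeta(h)$. These form the category $\mathsf{pGrp}$. An almost group is a pair $(G,\mathfrak{a})$ of a piecewise group $G$ and a self-action, i.e. a map $\mathfrak{a}:G\to\mathsf{pGrp}(G,G)$ assigning to every $g\in G$ a piecewise automorphism $\mathfrak{a}(g):G\to G$ such that for $g,h\in G$: $g$ commutes with $h$ if and only if $\mathfrak{a}(g)(h)=h$; and in this case $\mathfrak{a}(gh)=\mathfrak{a}(g)\mathfrak{a}(h)$. An almost group homomorphism $\zeta:(G,\mathfrak{a})\to(H,\mathfrak{b})$ is a piecewise group homomorphism $\zeta:G\to H$ with $\mathfrak{b}(\zeta(g))(\zeta(h))=\zeta(\mathfrak{a}(g)(h))$ for all $g,h\in G$. These form the category $\mathsf{aGrp}$. The forgetful functor $\mathsf{Grp}\to\mathsf{aGrp}$ sends a group $G$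 to the piecewise group with underlying set $G$, $g\mathrel{\perp\!\!\!\perp} h$ iff $gh=hg$, and multiplication restricted to commuting pairs, equipped with the self-action $\mathfrak{a}(g)(h)=g^{-1}hg$; it sends each group homomorphism to itself as a function. *)

(* Defs.v *)
From HB Require Import structures.
From mathcomp Require Import all_boot.
From mathcomp Require Import boolp classical_sets.

Set Implicit Arguments.
Unset Strict Implicit.
Unset Printing Implicit Defensive.

Local Open Scope group_scope.
Local Open Scope classical_set_scope.

Record category := Category {
  obj :> Type;
  hom : obj -> obj -> Type;
  idm : forall X, hom X X;
  mcomp : forall X Y Z, hom Y Z -> hom X Y -> hom X Z;
  comp_idl : forall X Y (f : hom X Y), mcomp (idm Y) f = f;
  comp_idr : forall X Y (f : hom X Y), mcomp f (idm X) = f;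
  comp_assoc : forall W X Y Z (h : hom Y Z) (g : hom X Y) (f : hom W X),
    mcomp h (mcomp g f) = mcomp (mcomp h g) f }.

Definition is_iso (C : category) (X Y : C) (f : hom X Y) : Prop :=
  exists g : hom Y X, mcomp g f = idm X /\ mcomp f g = idm Y.

Record functor (C D : category) := Functor {
  fobj :> C -> D;
  fmap : forall X Y, hom X Y -> hom (fobj X) (fobj Y);
  fmap_id : forall X, fmap (idm X) = idm (fobj X);
  fmap_comp : forall X Y Z (g : hom Y Z) (f : hom X Y),
    fmap (mcomp g f) = mcomp (fmap g) (fmap f) }.

Definition full (C D : category) (F : functor C D) : Prop :=
  forall (X Y : C) (f : hom (F X) (F Y)), exists g : hom X Y, fmap F g = f.

Definition pairwise_commuting (T : Type) (comm : T -> T -> Prop) (C : set T) :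
    Prop :=
  forall x y, C x -> C y -> comm x y.

(* The proofs of commutation are universally quantified below: this is only
   meant for pairwise commuting [D], where all of them exist. *)
Definition is_abelian_group (T : Type) (comm : T -> T -> Prop)
    (mul : forall x y, comm x y -> T) (one : T) (D : set T) : Prop :=
  [/\ D one /\ (forall x y (c : comm x y), D x -> D y -> D (mul x y c)),
      forall x y z (cxy : comm x y) (cyz : comm y z)
        (cl : comm (mul x y cxy) z) (cr : comm x (mul y z cyz)),
        D x -> D y -> D z -> mul _ _ cl = mul _ _ cr,
      forall x y (c : comm x y) (c' : comm y x),
        D x -> D y -> mul x y c = mul y x c',
      forall x (c : comm one x), D x -> mul one x c = x
    & forall x, D x -> exists y (c : comm x y), D y /\ mul x y c = one].

Record pgroup := PGroup {
  pcarrier :> Type;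
  pcomm : pcarrier -> pcarrier -> Prop;
  pmul : forall x y, pcomm x y -> pcarrier;
  pone : pcarrier;
  pcomm_refl : forall x, pcomm x x;
  pcomm_sym : forall x y, pcomm x y -> pcomm y x;
  pcomm_ext : forall C : set pcarrier, pairwise_commuting pcomm C ->
    exists D : set pcarrier,
      [/\ C `<=` D, pairwise_commuting pcomm D & is_abelian_group pmul pone D] }.

Record pgroup_hom (G H : pgroup) := PGroupHom {
  pfun :> G -> H;
  pfunM : forall (g h : G) (c : pcomm g h),
    exists d : pcomm (pfun g) (pfun h), pfun (pmul c) = pmul d }.

Lemma pgroup_hom_eq (G H : pgroup) (f g : pgroup_hom G H) :
  (forall x, f x = g x) -> f = g.
Proof.
case: f g => f fM [g gM] /= /funext e.
by subst g; congr PGroupHom; exact: Prop_irrelevance.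
Qed.

Definition pgroup_id (G : pgroup) : pgroup_hom G G :=
  @PGroupHom G G id (fun g h c => ex_intro _ c erefl).

Lemma pgroup_compM (G H K : pgroup) (f : pgroup_hom H K) (g : pgroup_hom G H)
    (x y : G) (c : pcomm x y) :
  exists d : pcomm (f (g x)) (f (g y)), f (g (pmul c)) = pmul d.
Proof. by have [d ->] := pfunM g c; exact: pfunM. Qed.

Definition pgroup_comp (G H K : pgroup)
    (f : pgroup_hom H K) (g : pgroup_hom G H) : pgroup_hom G K :=
  @PGroupHom G K (fun x => f (g x)) (@pgroup_compM G H K f g).

Definition pGrp : category.
Proof.
apply: (@Category pgroup pgroup_hom pgroup_id pgroup_comp) => *;
  exact: pgroup_hom_eq.
Defined.

Record agroup := AGroup {
  acarrier :> pgroup;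
  self_action : acarrier -> pgroup_hom acarrier acarrier;
  self_action_iso : forall g, @is_iso pGrp acarrier acarrier (self_action g);
  self_action_comm : forall g h, pcomm g h <-> self_action g h = h;
  self_actionM : forall g h (c : pcomm g h),
    self_action (pmul c) = pgroup_comp (self_action g) (self_action h) }.

Record agroup_hom (G H : agroup) := AGroupHom {
  afun :> pgroup_hom G H;
  afunJ : forall g h : G,
    self_action (afun g) (afun h) = afun (self_action g h) }.

Lemma agroup_hom_eq (G H : agroup) (f g : agroup_hom G H) :
  (forall x, f x = g x) -> f = g.
Proof.
case: f g => f fJ [g gJ] /= /pgroup_hom_eq e.
by subst g; congr AGroupHom; exact: Prop_irrelevance.
Qed.

Definition agroup_id (G : agroup) : agroup_hom G G :=
  @AGroupHom G G (pgroup_id G) (fun g h => erefl).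

Lemma agroup_compJ (G H K : agroup) (f : agroup_hom H K) (g : agroup_hom G H)
    (x y : G) :
  self_action (pgroup_comp f g x) (pgroup_comp f g y) =
  pgroup_comp f g (self_action x y).
Proof. by rewrite /= !afunJ. Qed.

Definition agroup_comp (G H K : agroup)
    (f : agroup_hom H K) (g : agroup_hom G H) : agroup_hom G K :=
  @AGroupHom G K (pgroup_comp f g) (@agroup_compJ G H K f g).

Definition aGrp : category.
Proof.
apply: (@Category agroup agroup_hom agroup_id agroup_comp) => *;
  exact: agroup_hom_eq.
Defined.

Notation group_hom := UMagmaMorphism.type.

Lemma group_hom_eq (G H : groupType) (f g : group_hom G H) :
  (forall x, f x = g x) -> f = g.
Proof.
case: f g => f [[f1] [fM]] [g [[g1] [gM]]] /= /funext e.
subst g; have -> : f1 = g1 by exact: Prop_irrelevance.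
by have -> : fM = gM by exact: Prop_irrelevance.
Qed.

(* A [groupType] also carries a choice operator, which morphisms ignore; this
   does not affect the category up to equivalence, since classically every type
   has such an operator. *)
Definition Grp : category.
Proof.
apply: (@Category groupType (fun G H => group_hom G H)
  (fun G => idfun : group_hom G G)
  (fun G H K f g => (f \o g)%FUN : group_hom G K)) => *; exact: group_hom_eq.
Defined.

Lemma commute_ext (G : groupType) (C : set G) :
  pairwise_commuting (@commute G) C ->
  exists D : set G,
    [/\ C `<=` D, pairwise_commuting (@commute G) D
      & is_abelian_group (fun x y (_ : commute x y) => x * y) 1 D].
Proof.
move=> cC.
exists [set x | forall y, (forall z, C z -> commute y z) -> commute x y].
split=> [x Cx y cy|x y Dx Dy|].
- exact/commute_sym/cy.
- by apply: Dx => z Cz; apply: Dy => t Ct; exact: cC.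
split.
- split=> [y _|x y _ Dx Dy z cz]; first exact/commute_sym/commute1.
  by apply/commute_sym/commuteM; apply/commute_sym; [exact: Dx|exact: Dy].
- by move=> x y z *; rewrite mulgA.
- by [].
- by move=> x *; rewrite mul1g.
move=> x Dx; exists x^-1, (commuteV (commute_refl x)); split; last exact: mulgV.
by move=> y cy; apply/commute_sym/commuteV/commute_sym/Dx.
Qed.

Definition pgroup_of (G : groupType) : pgroup :=
  @PGroup G (@commute G) (fun x y _ => x * y) 1
    (@commute_refl G) (@commute_sym G) (@commute_ext G).

(* [h ^ g] is g^-1 * (h * g). *)
Lemma conj_pfunM (G : groupType) (g x y : pgroup_of G) (c : pcomm x y) :
  exists d : @pcomm (pgroup_of G) (x ^ g) (y ^ g), pmul c ^ g = pmul d.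
Proof.
have d : commute (x ^ g) (y ^ g) by rewrite /commute -!conjMg c.
by exists d; rewrite /= conjMg.
Qed.

Definition conj_action (G : groupType) (g : G) :
    pgroup_hom (pgroup_of G) (pgroup_of G) :=
  @PGroupHom (pgroup_of G) (pgroup_of G) (fun h : G => h ^ g)
    (@conj_pfunM G g).

Lemma conj_action_iso (G : groupType) (g : G) :
  @is_iso pGrp (pgroup_of G) (pgroup_of G) (conj_action g).
Proof.
exists (conj_action g^-1).
by split; apply: pgroup_hom_eq => x /=; rewrite ?conjgK ?conjgKV.
Qed.

Lemma conj_action_comm (G : groupType) (g h : pgroup_of G) :
  pcomm g h <-> conj_action (g : G) h = h.
Proof.
rewrite /= /commute conjgE; split=> [<-|e]; first by rewrite mulKg.
by rewrite -{1}e mulVKg.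
Qed.

Lemma conj_actionM (G : groupType) (g h : pgroup_of G) (c : pcomm g h) :
  conj_action (pmul c : G) =
  pgroup_comp (conj_action (g : G)) (conj_action (h : G)).
Proof. by apply: pgroup_hom_eq => x /=; rewrite c conjgM. Qed.

Definition agroup_of (G : groupType) : agroup :=
  @AGroup (pgroup_of G) (@conj_action G) (@conj_action_iso G)
    (@conj_action_comm G) (@conj_actionM G).

Lemma group_hom_pfunM (G H : groupType) (f : group_hom G H)
    (x y : pgroup_of G) (c : pcomm x y) :
  exists d : @pcomm (pgroup_of H) (f x) (f y), f (pmul c) = pmul d.
Proof.
have d : commute (f x) (f y) by rewrite /commute -!gmulfM c.
by exists d; rewrite /= gmulfM.
Qed.

Definition pgroup_hom_of (G H : groupType) (f : group_hom G H) :
    pgroup_hom (pgroup_of G) (pgroup_of H) :=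
  @PGroupHom (pgroup_of G) (pgroup_of H) f (group_hom_pfunM f).

Lemma group_hom_afunJ (G H : groupType) (f : group_hom G H)
    (x y : agroup_of G) :
  @self_action (agroup_of H) (pgroup_hom_of f x) (pgroup_hom_of f y) =
  pgroup_hom_of f (self_action x y).
Proof. by rewrite /= gmulfJ. Qed.

Definition agroup_hom_of (G H : groupType) (f : group_hom G H) :
    agroup_hom (agroup_of G) (agroup_of H) :=
  @AGroupHom (agroup_of G) (agroup_of H) (pgroup_hom_of f) (group_hom_afunJ f).

Definition forgetful : functor Grp aGrp.
Proof.
apply: (@Functor Grp aGrp agroup_of agroup_hom_of) => *; exact: agroup_hom_eq.
Defined.

(* Main.v *)
From HB Require Import structures.
From mathcomp Require Import all_boot.
Require Import Defs.

Set Implicit Arguments.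
Unset Strict Implicit.
Unset Printing Implicit Defensive.

Local Open Scope group_scope.

(** A function between groups is an almost group homomorphism as soon as it is
    multiplicative on commuting pairs and respects conjugation, so a function
    that satisfies both but is not multiplicative everywhere refutes fullness.

    In a group with centre of index 4, two elements from distinct nontrivial
    cosets of the centre generate the group together with the centre; they do
    not commute, since otherwise they would be central.  Hence a commuting pair
    maps into a subgroup of order at most 2 of the quotient by the centre, which
    is a Klein four-group.

    The function sending central elements to the identity and all others to a
    fixed central involution is multiplicative on such pairs, and it is a class
    function with central values, so it respects conjugation.  It is not
    multiplicative on a noncommuting pair: the two factors and their product
    are all noncentral.

    The dihedral group of order 8, written as the upper unitriangular 3 by 3
    matrices over the field with two elements, is such a group. *)

(** ((a, b), c) stands for the unitriangular matrix with a and b just above the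
    diagonal and c in the corner; the field operations are (+) and &&. *)
Definition heisenberg2 : Type := bool * bool * bool.

HB.instance Definition _ := Choice.on heisenberg2.

Implicit Types x y : heisenberg2.

Definition hmul x y : heisenberg2 :=
  (x.1.1 (+) y.1.1, x.1.2 (+) y.1.2, x.2 (+) y.2 (+) (x.1.1 && y.1.2)).

Definition hinv x : heisenberg2 := (x.1, x.2 (+) (x.1.1 && x.1.2)).

Definition hone : heisenberg2 := (false, false, false).

Lemma hmulA : associative hmul.
Proof. by do 3![case=> [[[] []] []]]. Qed.

Lemma hmul1 : left_id hone hmul.
Proof. by case=> [[[] []] []]. Qed.

Lemma hmulV : left_inverse hone hinv hmul.
Proof. by case=> [[[] []] []]. Qed.

Lemma hmulr1 : right_id hone hmul.
Proof. by case=> [[[] []] []]. Qed.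

Lemma hmulrV : right_inverse hone hinv hmul.
Proof. by case=> [[[] []] []]. Qed.

HB.instance Definition _ :=
  isGroup.Build heisenberg2 hmulA hmul1 hmulr1 hmulV hmulrV.

(** The centre consists of the elements with a = b = false, and the central
    involution is the element with only the corner entry nonzero. *)
Definition noncentrality x : heisenberg2 := (false, false, x.1.1 || x.1.2).

(** Two commuting noncentral elements lie in the same coset of the centre, so
    their product is a square modulo the centre, hence central; on the right the
    involution occurs twice and cancels. *)
Lemma noncentralityM x y :
  commute x y -> noncentrality (x * y) = noncentrality x * noncentrality y.
Proof. by case: x y => [[[] []] []] [[[] []] []]. Qed.

Lemma noncentralityJ x y :
  noncentrality (x ^ y) = noncentrality x ^ noncentrality y.
Proof. by case: x y => [[[] []] []] [[[] []] []]. Qed.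

Lemma noncentrality_pfunM (x y : pgroup_of heisenberg2) (c : pcomm x y) :
  exists d : @pcomm (pgroup_of heisenberg2) (noncentrality x) (noncentrality y),
    noncentrality (pmul c) = pmul d.
Proof.
have d : commute (noncentrality x) (noncentrality y).
  by rewrite /commute -!noncentralityM ?c //; exact: commute_sym.
by exists d; exact: noncentralityM.
Qed.

Definition noncentrality_ahom :
    agroup_hom (agroup_of heisenberg2) (agroup_of heisenberg2) :=
  @AGroupHom (agroup_of heisenberg2) (agroup_of heisenberg2)
    (@PGroupHom (pgroup_of heisenberg2) (pgroup_of heisenberg2)
       noncentrality noncentrality_pfunM)
    (fun x y => esym (noncentralityJ y x)).

Theorem theorem6p5 : ~ full forgetful.
Proof.
move=> /(_ heisenberg2 heisenberg2 noncentrality_ahom) [g eg].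
have gE x : g x = noncentrality x.
  by rewrite -[LHS]/(agroup_hom_of g x) [agroup_hom_of g]eg.
(* The two generating elementary matrices do not commute, so that each of them
   and their product are noncentral. *)
pose u : heisenberg2 := (true, false, false).
pose v : heisenberg2 := (false, true, false).
have : g (u * v) = g u * g v by rewrite gmulfM.
by rewrite !gE.
Qed.
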